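(* Let $H\in C^2(\mathbb{R}^N\otimes\mathbb{R}^n)$ and suppose that there exist $a,b\in\mathbb{R}^n$, $\eta\in\mathbb{R}^N$, $c\in\mathbb{R}$ and $\mathbf{C}\in\mathbb{R}^N\otimes\mathbb{R}^n$ such that $$[\eta\otimes a,\ \eta\otimes b]\ \subseteq\ \{H=c\}\cap\{H_P=\mathbf{C}\}.$$ Let $K\in C^0(\mathbb{R})$ with $\|K\|_{C^0(\mathbb{R})}=\sup_{\mathbb{R}}|K|<1$ and define $u:\mathbb{R}^n\to\mathbb{R}^N$ by $$u(x):=\left(x^\top\Big(\frac{b+a}{2}\Big)+\int_0^{x^\top\left(\frac{b-a}{2}\right)}K(t)\,dt\right)\eta .$$ Then $u$ is an everywhere solution in $C^1(\mathbb{R}^n)^N$ of the PDE system $$H_P(Du)\,D\big(H(Du)\big)+H(Du)\,[H_P(Du)]^\perp\,\mathrm{Div}\big(H_P(Du)\big)=0 .$$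
   Context: $\mathbb{R}^N\otimes\mathbb{R}^n$ is the space of real $N\times n$ matrices; $\eta\otimes a$ is the rank-one matrix $(\eta_\alpha a_i)$; $[\eta\otimes a,\eta\otimes b]$ is the straight line segment in $\mathbb{R}^N\otimes\mathbb{R}^n$ joining these two matrices. $Du=(D_iu_\alpha)$ is the $N\times n$ gradient matrix, $H_P=(\partial H/\partial P_{\alpha i})$, and $[H_P(Du)]^\perp$ is the orthogonal projection of $\mathbb{R}^N$ on the null space of $H_P(Du)^\top:\mathbb{R}^N\to\mathbb{R}^n$. $\big(\mathrm{Div}(H_P(Du))\big)_\alpha=\sum_iD_i\big(H_{P_{\alpha i}}(Du)\big)$. ''Everywhere solution'' means that $u\in C^1(\mathbb{R}^n)^N$, the compositions $x\mapsto H(Du(x))$ and $x\mapsto H_P(Du(x))$ are everywhere differentiable, and the system holds at every point of $\mathbb{R}^n$ with these classical derivatives (no second derivatives of $u$ are required to exist). *)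

(* Defs.v *)
From mathcomp Require Import all_boot all_order all_algebra.
From mathcomp Require Import all_classical all_reals all_analysis.

Set Implicit Arguments.
Unset Strict Implicit.
Unset Printing Implicit Defensive.

Import Order.TTheory GRing.Theory Num.Theory.
Import numFieldNormedType.Exports.

Local Open Scope classical_set_scope.
Local Open Scope ring_scope.

(* R^n is 'cV[R]_n and R^N (x) R^n is 'M[R]_(N, n). Their library norm is the
   max norm, which has the same topology and the same (Frechet)
   differentiability notion as the Euclidean one. *)

Section Regularity.
Context {R : realType} {V W : normedModType R}.

(* Used for finite-dimensional V only, where continuity of every directional
   derivative amounts to continuity of the differential. *)
Definition C1 (f : V -> W) : Prop :=
  (forall x, differentiable f x) /\ (forall v, continuous ('D_v f)).

Definition C2 (f : V -> W) : Prop := C1 f /\ (forall v, C1 ('D_v f)).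

End Regularity.

Section DifferentialOperators.
Context {R : realType}.

Definition partial n (W : normedModType R) (i : 'I_n) (f : 'cV[R]_n -> W)
    (x : 'cV[R]_n) : W :=
  'D_(delta_mx i 0) f x.

Definition grad n (f : 'cV[R]_n -> R) (x : 'cV[R]_n) : 'cV[R]_n :=
  \col_i partial i f x.

Definition Dmx N n (u : 'cV[R]_n -> 'cV[R]_N) (x : 'cV[R]_n) : 'M[R]_(N, n) :=
  \matrix_(al, i) partial i (fun y => u y al 0) x.

Definition Div N n (F : 'cV[R]_n -> 'M[R]_(N, n)) (x : 'cV[R]_n) : 'cV[R]_N :=
  \col_al \sum_i partial i (fun y => F y al i) x.

(* The matrix H_P of partial derivatives of H. *)
Definition gradP N n (H : 'M[R]_(N, n) -> R) (P : 'M[R]_(N, n)) :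
    'M[R]_(N, n) :=
  \matrix_(al, i) 'D_(delta_mx al i) H P.

End DifferentialOperators.

Section Perp.
Context {R : realType} {N n : nat}.

(* [A]^perp, acting on column vectors by left multiplication. MathComp's
   subspaces are row spaces: the rows of [kermx A] span the transposes of the
   v : 'cV_N with A^T *m v = 0, and [orthomx idfun 1%:M] is the orthogonal
   complement for the standard dot product. *)
Definition perp (A : 'M[R]_(N, n)) : 'M[R]_N :=
  (proj_mx (kermx A) (orthomx idfun 1%:M (kermx A)))^T.

Lemma orthomx_dot m (v : 'rV[R]_N) (B : 'M[R]_(m, N)) :
  (v <= orthomx idfun 1%:M B)%MS = (v *m B^T == 0).
Proof. by rewrite /orthomx sub_kermx mul1mx map_mx_id. Qed.

Lemma perp_ker (A : 'M[R]_(N, n)) (v : 'cV[R]_N) : A^T *m (perp A *m v) = 0.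
Proof.
apply: trmx_inj; rewrite !trmx_mul !trmxK trmx0.
by apply/sub_kermxP; exact: proj_mx_sub.
Qed.

Lemma perp_orth (A : 'M[R]_(N, n)) (v w : 'cV[R]_N) :
  A^T *m w = 0 -> (v - perp A *m v)^T *m w = 0.
Proof.
move=> Aw.
have dot0 (z : 'rV[R]_N) : z *m z^T = 0 -> z = 0.
  move=> /matrixP/(_ 0 0); rewrite !mxE => /eqP.
  rewrite psumr_eq0 => [/allP zz|i _]; last by rewrite mxE -expr2 sqr_ge0.
  apply/rowP => i; have := zz i (mem_index_enum _).
  by rewrite !mxE /= mulf_eq0 orbb => /eqP.
set K := kermx A; set L := orthomx idfun 1%:M K.
have KL0 : (K :&: L = 0)%MS.
  apply/eqP/rowV0P => z; rewrite sub_capmx => /andP[zK].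
  rewrite orthomx_dot => /eqP zKT; apply: dot0.
  have /submxP[D zD] := zK.
  by rewrite {1}zD -mulmxA -[K *m _]trmxK trmx_mul trmxK zKT trmx0 mulmx0.
have KLfull : (v^T <= K + L)%MS.
  apply: submx_full; rewrite /row_full; apply/eqP.
  have := mxrank_disjoint_sum KL0; rewrite /= => ->.
  rewrite /L /orthomx mxrank_ker mul1mx map_mx_id // mxrank_tr.
  by rewrite subnKC // rank_leq_col.
have -> : (v - perp A *m v)^T = v^T *m proj_mx L K.
  apply/eqP; rewrite linearB /= trmx_mul trmxK subr_eq addrC.
  by rewrite add_proj_mx.
have : (v^T *m proj_mx L K <= L)%MS by exact: proj_mx_sub.
rewrite orthomx_dot => /eqP LK.
have /submxP[D wD] : (w^T <= K)%MS.
  by apply/sub_kermxP; rewrite -[A]trmxK -trmx_mul Aw trmx0.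
by rewrite -[w]trmxK wD trmx_mul mulmxA LK mul0mx.
Qed.

End Perp.

Section System.
Context {R : realType} {N n : nat}.

Definition everywhere_solution (H : 'M[R]_(N, n) -> R)
    (u : 'cV[R]_n -> 'cV[R]_N) : Prop :=
  let HD := fun x => H (Dmx u x) in
  let HPD := fun x => gradP H (Dmx u x) in
  [/\ C1 u,
      forall x, differentiable HD x,
      forall x, differentiable HPD x &
      forall x, HPD x *m grad HD x + HD x *: (perp (HPD x) *m Div HPD x) = 0].

Definition tensor (eta : 'cV[R]_N) (a : 'cV[R]_n) : 'M[R]_(N, n) :=
  \matrix_(al, i) (eta al 0 * a i 0).

Definition segment (A B : 'M[R]_(N, n)) : set 'M[R]_(N, n) :=
  [set (1 - t) *: A + t *: B | t in `[0, 1]].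

End System.

Definition dot {R : realType} {n : nat} (x y : 'cV[R]_n) : R := (x^T *m y) 0 0.

(* The oriented integral of K from 0 to s, for s of any sign. *)
Definition int0 {R : realType} (K : R -> R) (s : R) : R :=
  if 0 <= s then \int[lebesgue_measure]_(t in `[0, s]) K t
  else - \int[lebesgue_measure]_(t in `[s, 0]) K t.

(* Main.v *)
(* [Du(x)] is the matrix [eta (x) ((b + a)/2 + K(s) (b - a)/2)] with
   [s = x^T (b - a)/2]. As [|K| <= 1] it lies on the segment
   [[eta (x) a, eta (x) b]], so [H(Du)] and [H_P(Du)] are constant and both
   terms of the system vanish. *)
Require Import Defs.
From HB Require Import structures.
From mathcomp Require Import all_boot all_order all_algebra.
From mathcomp Require Import all_classical all_reals all_analysis.
From mathcomp Require Import ring lra.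
Import Order.TTheory GRing.Theory Num.Theory.
Import numFieldNormedType.Exports.
Local Open Scope classical_set_scope.
Local Open Scope ring_scope.

Lemma continuous_itv_integrable {R : realType} (K : R -> R) (a b : R) :
  continuous K -> (@lebesgue_measure R).-integrable `[a, b] (EFin \o K).
Proof.
move=> cK; apply: continuous_compact_integrable; first exact: segment_compact.
exact: continuous_subspaceT.
Qed.

(* Any base point [a <= 0] to the left of [s] turns the oriented integral into
   an instance of [continuous_FTC1_closed], whatever the sign of [s]. *)
Lemma int0E {R : realType} (K : R -> R) (a s : R) : continuous K ->
  a <= 0 -> a <= s ->
  int0 K s = \int[lebesgue_measure]_(t in `[a, s]) K t
           - \int[lebesgue_measure]_(t in `[a, 0]) K t.
Proof.
move=> cK a0 as_; rewrite /int0.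
have iK x y := continuous_itv_integrable K x y cK.
(* Subtracting two closed-interval integrals leaves a half-open interval; integrability there allows
   its missing endpoint to be put back. *)
have iKo x y : (@lebesgue_measure R).-integrable `]x, y] (EFin \o K).
  by apply: integrableS (iK x y) => //; exact: subset_itv_oc_cc.
case: (leP 0 s) => [s0|/ltW s0].
  by rewrite Rintegral_itvB ?bnd_simp// Rintegral_itv_obnd_cbnd.
rewrite -[RHS]opprB; congr (- _).
by rewrite Rintegral_itvB ?bnd_simp// Rintegral_itv_obnd_cbnd.
Qed.

Lemma is_derive_int0 {R : realType} (K : R -> R) (s : R) : continuous K ->
  is_derive s 1 (int0 K) (K s).
Proof.
(* [a] lies strictly to the left of both [0] and [s], so [int0E] applies at every [y] near [s], and
   [s] is interior to [[a, s + 1]], as the fundamental theorem of calculus requires. *)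
move=> cK; set a : R := Num.min 0 s - 1.
have a0 : a < 0 by rewrite /a ltrBlDr add0r gt_min ltr01.
have as_ : a < s by rewrite /a ltrBlDr gt_min ltrDl ltr01 orbT.
pose F y := \int[lebesgue_measure]_(t in `[a, y]) K t.
have s1 : s < s + 1 by rewrite ltrDl.
have [dF F'] := continuous_FTC1_closed s1
  (continuous_itv_integrable K a (s + 1) cK) as_ (cK s).
(* Near [s] the oriented integral is [F] minus a constant, so both have the same derivative at
   [s]. *)
apply: (@near_eq_is_derive _ _ _ (F - cst (F 0))).
  near=> y; rewrite (int0E K a y) ?ltW//.
  by near: y; exact: lt_nbhsr.
have dF' : is_derive s 1 F (K s).
  by apply: DeriveDef => //; rewrite -derive1E F'.
by apply: is_derive_eq; rewrite subr0.
Unshelve. all: by end_near. Qed.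

Lemma dotE {R : realType} {n : nat} (x y : 'cV[R]_n) :
  dot x y = \sum_i x i 0 * y i 0.
Proof. by rewrite /dot mxE; apply: eq_bigr => i _; rewrite mxE. Qed.

Lemma dot_delta {R : realType} {n : nat} (i : 'I_n) (y : 'cV[R]_n) :
  dot (delta_mx i 0) y = y i 0.
Proof. by rewrite /dot trmx_delta -rowE mxE. Qed.

(** A continuous linear map is its own differential; continuity follows from the expansion as a
    finite sum over coordinates. *)
Lemma is_diff_dot {R : realType} {n : nat} (w x : 'cV[R]_n) :
  is_diff x (fun y => dot y w) (fun y => dot y w).
Proof.
have dot_lin : linear (fun y : 'cV[R]_n => dot y w).
  by move=> k y z; rewrite /dot linearP /= mulmxDl -scalemxAl !mxE.
pose dotM := GRing.isLinear.Build _ _ _ _ _ dot_lin.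
pose dotL : {linear _ -> _} := HB.pack (fun y : 'cV[R]_n => dot y w) dotM.
have cdot : continuous dotL.
  move=> y; apply: differentiable_continuous.
  rewrite (_ : dotL = \sum_i (fun z : 'cV[R]_n => z i 0 * w i 0) :> (_ -> _)).
    apply: differentiable_sum => i; apply: differentiableM => //.
    exact: differentiable_coord.
  by apply/funext => z; rewrite fct_sumE -dotE.
rewrite -[X in is_diff _ X]/(dotL : _ -> _).
by apply: DiffDef; [exact: linear_differentiable | rewrite diff_lin].
Qed.

Lemma continuous_dot {R : realType} {n : nat} (w : 'cV[R]_n) :
  continuous (fun y => dot y w).
Proof.
by move=> y; apply: differentiable_continuous; case: (is_diff_dot w y).
Qed.

Section RankOneProfile.
Context {R : realType} {N n : nat}.
Variables (p q : 'cV[R]_n) (eta : 'cV[R]_N) (K : R -> R).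
Hypothesis cK : continuous K.

Let u (x : 'cV[R]_n) : 'cV[R]_N := (dot x p + int0 K (dot x q)) *: eta.

(** Chain rule: [int0 K] has derivative [K], and both dot products are linear in [x]. *)
Lemma is_diff_profile (x : 'cV[R]_n) :
  is_diff x u (fun v => (dot v p + K (dot x q) * dot v q) *: eta).
Proof.
have dI : is_diff (dot x q) (int0 K) ( *:%R^~ (K (dot x q))).
  have [dK K'] := is_derive_int0 K (dot x q) cK.
  apply: DiffDef; first exact/derivable1_diffP.
  by rewrite deriv1E // derive1E K'.
have dp := is_diff_dot p x; have dq := is_diff_dot q x.
have dg := is_diffD dp (is_diff_comp dq dI).
apply: DiffDef; first by apply: differentiableZl; case: dg.
rewrite diffZl; last by case: dg.
rewrite diff_val; apply/funext => v /=; congr (_ *: _).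
by rewrite /= !fctE [_ *: _]mulrC.
Qed.

Lemma derive_profile (x v : 'cV[R]_n) :
  'D_v u x = (dot v p + K (dot x q) * dot v q) *: eta.
Proof.
have du := is_diff_profile x.
by rewrite deriveE ?diff_val //; case: du.
Qed.

Lemma C1_profile : C1 u.
Proof.
split=> [x|v]; first by case: (is_diff_profile x).
rewrite (_ : 'D_v u =
    fun x => (dot v p + K (dot x q) * dot v q) *: eta); last first.
  by apply/funext => x; exact: derive_profile.
move=> x; apply: (@continuousZr_tmp _ 'cV[R]_N _
  (fun y => dot v p + K (dot y q) * dot v q)).
apply: continuousD; first exact: cst_continuous.
apply: continuousM; last exact: cst_continuous.
by apply: continuous_comp; [exact: continuous_dot | exact: cK].
Qed.

(** The directional derivatives along the basis vectors give the columns of the gradient. It stays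
    of rank at most one, with [eta] fixed, and depends on [x] only through the scalar
    [K (dot x q)]. *)
Lemma Dmx_profile (x : 'cV[R]_n) :
  Dmx u x = tensor eta (p + K (dot x q) *: q).
Proof.
apply/matrixP => al i; rewrite !mxE /partial.
have du : derivable u x (delta_mx i 0).
  by apply: diff_derivable; case: (is_diff_profile x).
have := derive_profile x (delta_mx i 0).
rewrite (derive_mx du) => /matrixP/(_ al 0); rewrite !mxE => ->.
by rewrite !dot_delta mulrC.
Qed.

End RankOneProfile.

(** The system differentiates only the compositions with [Dmx u], never [Dmx u] itself. When these
    are constant, [grad] kills the first term and [Div] the second. *)
Lemma everywhere_solution_cst {R : realType} {N n : nat}
    (H : 'M[R]_(N, n) -> R) (u : 'cV[R]_n -> 'cV[R]_N) (c : R)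
    (C : 'M[R]_(N, n)) :
  C1 u -> (forall x, H (Dmx u x) = c) -> (forall x, gradP H (Dmx u x) = C) ->
  everywhere_solution H u.
Proof.
move=> u1 Hc HPC; rewrite /everywhere_solution /=.
have -> : (fun x => H (Dmx u x)) = cst c by apply/funext.
have -> : (fun x => gradP H (Dmx u x)) = cst C by apply/funext.
split=> // x.
have -> : grad (cst c) x = 0.
  by apply/matrixP => i j; rewrite !mxE /partial derive_cst.
have -> : Div (cst C) x = 0.
  apply/matrixP => i j; rewrite !mxE big1 // => k _.
  by rewrite /partial derive_cst.
by rewrite !mulmx0 scaler0 addr0.
Qed.

Lemma tensor_segment {R : realType} {N n : nat} (eta : 'cV[R]_N)
    (a b : 'cV[R]_n) (k : R) : `|k| <= 1 ->
  segment (tensor eta a) (tensor eta b)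
    (tensor eta (2^-1 *: (b + a) + k *: (2^-1 *: (b - a)))).
Proof.
(* The parameter [t = (1 + k) / 2] solves [(1 - t) a + t b = (b + a) / 2 + k (b - a) / 2], and it
   maps [[-1, 1]] onto [[0, 1]]. *)
rewrite ler_norml => /andP[k1 k2]; exists ((1 + k) / 2) => /=.
  by rewrite in_itv /=; apply/andP; split; lra.
by apply/matrixP => i j; rewrite !mxE; field.
Qed.

Theorem proposition6p2 (R : realType) (N n : nat) (H : 'M[R]_(N, n) -> R)
    (hH : C2 H) (a b : 'cV[R]_n) (eta : 'cV[R]_N) (c : R) (C : 'M[R]_(N, n))
    (hseg : segment (tensor eta a) (tensor eta b) `<=`
            [set P | H P = c] `&` [set P | gradP H P = C])
    (K : R -> R) (hK : continuous K)
    (* extended-real supremum: the real-valued one is 0 on unbounded sets *)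
    (hK1 : (ereal_sup [set `|K t|%:E | t in [set: R]] < 1)%E) :
  everywhere_solution H
    (fun x : 'cV[R]_n =>
       (dot x (2^-1 *: (b + a)) + int0 K (dot x (2^-1 *: (b - a)))) *: eta).
Proof.
have K1 t : `|K t| <= 1.
  rewrite -lee_fin; apply: le_trans (ltW hK1).
  by apply: ereal_sup_ubound; exists t.
(* Here [x] is a real number. At the value [dot x (2^-1 *: (b - a))] for a point [x], the matrix is
   the gradient given by [Dmx_profile]. *)
have Pseg x := hseg _ (tensor_segment eta a b _ (K1 x)).
apply: (@everywhere_solution_cst _ _ _ _ _ c C); first exact: C1_profile.
  by move=> x; rewrite Dmx_profile //; case: (Pseg (dot x (2^-1 *: (b - a)))).
by move=> x; rewrite Dmx_profile //; case: (Pseg (dot x (2^-1 *: (b - a)))).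
Qed.
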